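(* For any $0<\alpha<1$, $0<\mu\le 2$ and $\zeta>0$, there exist positive constants $C_1^\alpha$ and $C_2^\alpha$ such that for the random graph process $\{G_t^\alpha:t\ge 1\}$ with parameters $\alpha,\mu,\zeta$, $$C_1^\alpha k^{-\beta}\le\liminf_{t\to\infty}\frac{\overline{D}_k(t)}{t}\le\limsup_{t\to\infty}\frac{\overline{D}_k(t)}{t}\le C_2^\alpha k^{-\beta}$$ for all $k\ge1$, where $\beta=1+2\left(1+\frac{(1-\alpha)\zeta}{\alpha\mu}\right)$.
   Context: Here $u\wedge v=\min(u,v)$. For constants $0\le\alpha\le1$ and $\mu,\zeta>0$, the random graph process $\{G^\alpha_t=(V_t,E_t):t\ge1\}$ is defined as follows. Time-Step 1: $G_1^\alpha$ consists of two vertices $x_0,x_1$ and the edge $\langle x_0,x_1\rangle$. Time-Step $t\ge2$: a new vertex $x_t$ is added to $G^\alpha_{t-1}$, and then: (1) with probability $\alpha$, random edges incident with $x_t$ are added in the preferential attachment manner: for each $0\le i\le t-1$, the edge $\langle x_i,x_t\rangle$ is added independently with probability $\frac{\mu\, d^\alpha_{x_i}(t-1)}{2e_{t-1}}\wedge1$, where $d^\alpha_{x_i}(t-1)$ is the degree of $x_i$ in $G^\alpha_{t-1}$ and $e_{t-1}=|E_{t-1}|$; (2) with probability $1-\alpha$, random edges incident with $x_t$ are added in the classical manner: for each $0\le i\le t-1$, the edge $\langle x_i,x_t\rangle$ is added independently with probability $(\zeta\wedge t)/t$. $D_k(t)$ denotes the number of vertices of degree $k$ in $G^\alpha_t$ and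 $\overline{D}_k(t)=\mathbb{E}(D_k(t))$. *)

(* Defs.v *)
From HB Require Import structures.
From mathcomp Require Import all_boot all_order all_algebra.
From mathcomp Require Import all_classical all_reals all_analysis.

Set Implicit Arguments.
Unset Strict Implicit.
Unset Printing Implicit Defensive.

Import Order.TTheory GRing.Theory Num.Theory.

Local Open Scope ring_scope.

(* A graph on the vertices x_0, ..., x_t, given by its set of edges, an edge
   being the set of its two endpoints.  The type does not exclude elements that
   are not pairs; none occur in [initial_graph] nor are added by [extend]. *)
Definition graph (t : nat) : finType := {set {set 'I_t.+1}}.

Definition degree t (g : graph t) (i : 'I_t.+1) : nat :=
  #|[set e in g | i \in e]%SET|.

Definition num_edges t (g : graph t) : nat := #|g|.

Definition num_degree (k : nat) t (g : graph t) : nat :=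
  #|[set i : 'I_t.+1 | degree g i == k]%SET|.

Definition initial_graph : graph 1 := [set [set ord0; ord_max]]%SET.

Definition old_vertex t (i : 'I_t.+1) : 'I_t.+2 := widen_ord (leqnSn t.+1) i.

(* Add to g the vertex x_{t+1}, joined exactly to the x_i with i in S. *)
Definition extend t (g : graph t) (S : {set 'I_t.+1}) : graph t.+1 :=
  ([set [set old_vertex i | i in e] | e : {set 'I_t.+1} in g]
   :|: [set [set old_vertex i; ord_max] | i in S])%SET.

Section Process.
Context {R : realType}.

(* Probability that S is exactly the set of successes among independent trials,
   trial i succeeding with probability p i. *)
Definition independent_trials (I : finType) (p : I -> R) (S : {set I}) : R :=
  (\prod_(i in S) p i) * \prod_(i in ~: S) (1 - p i).

Definition pref_prob (mu : R) t (g : graph t) (i : 'I_t.+1) : R :=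
  Num.min (mu * (degree g i)%:R / (2 * (num_edges g)%:R)) 1.

(* The vertex arriving after a graph on x_0, ..., x_t is x_{t+1}, added at
   time-step t+1. *)
Definition classical_prob (zeta : R) t (i : 'I_t.+1) : R :=
  Num.min zeta t.+1%:R / t.+1%:R.

(* Probability that the set of neighbours of x_{t+1} is S, given that the
   current graph is g: a single choice, made with probability alpha, selects
   the manner in which all the new edges are drawn. *)
Definition attach_prob (alpha mu zeta : R) t (g : graph t)
    (S : {set 'I_t.+1}) : R :=
  alpha * independent_trials (pref_prob mu g) S
  + (1 - alpha) * independent_trials (@classical_prob zeta t) S.

(* The event that the process has followed the history h at times 1, ..., t. *)
Definition follows T (G : forall t, T -> graph t) (h : forall t, graph t)
    (t : nat) : set T :=
  [set w | forall s, (0 < s <= t)%N -> G s w = h s]%classic.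

(* Times start at 1: nothing is required of G 0.  The step condition is the
   conditional law of G (t+1) given G 1, ..., G t, with the conditioning
   probability multiplied out. *)
Record is_graph_process (alpha mu zeta : R) (d : measure_display)
    (T : measurableType d) (P : probability T R)
    (G : forall t, T -> graph t) : Prop := {
  process_measurable : forall t (g : graph t), (0 < t)%N ->
    measurable [set w | G t w = g]%classic ;
  process_init : P [set w | G 1%N w = initial_graph]%classic = 1%E ;
  process_step : forall t (h : forall s, graph s) (S : {set 'I_t.+1}),
    (0 < t)%N ->
    P (follows G h t `&` [set w | G t.+1 w = extend (h t) S])%classic
    = (P (follows G h t) * (attach_prob alpha mu zeta (h t) S)%:E)%E }.

Definition mean_num_degree (d : measure_display) (T : measurableType d)
    (P : probability T R) (G : forall t, T -> graph t) (k t : nat) : \bar R :=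
  ('E_P[fun w => (num_degree k (G t w))%:R])%E.

Definition mean_proportion (d : measure_display) (T : measurableType d)
    (P : probability T R) (G : forall t, T -> graph t) (k t : nat) : \bar R :=
  (mean_num_degree P G k t * (t%:R^-1)%:E)%E.

Definition degree_exponent (alpha mu zeta : R) : R :=
  1 + 2 * (1 + (1 - alpha) * zeta / (alpha * mu)).

End Process.

(* Main.v *)
Require Import Defs.
From mathcomp Require Import all_boot all_order all_algebra.
From mathcomp Require Import all_classical all_reals all_analysis.
From mathcomp Require Import measurable_realfun.
From mathcomp Require Import ring lra zify.
Set Implicit Arguments.
Unset Strict Implicit.
Unset Printing Implicit Defensive.
Import Order.TTheory GRing.Theory Num.Theory.
Local Open Scope ring_scope.

(** Let e_t be the number of edges at time t, N_k the number of vertices of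
    degree k, and m = alpha mu + (1 - alpha) zeta.  As mu <= 2, the
    preferential probabilities mu d / (2 e) never exceed 1, so that by the
    handshake identity a new vertex brings mu edges on average under the
    preferential rule, and zeta under the classical one as soon as t >= zeta.
    Hence e_t - m t has bounded conditional variance and no drift, and
    E (e_t - m t)^2 = O(t) ([edge_variance_bound]).

    A vertex of degree k gains an edge at time t + 1 with probability close to
    (A k + B) / t, where A = alpha mu / (2 m) and B = (1 - alpha) zeta.  The
    error made by replacing e_t by m t is harmless because k N_k <= 2 e_t
    ([gain_approx], [gain_error_small]).  So n_k = E N_k satisfies, up to o(1),
<<
      n_k (t+1) = (1 - (A k + B) / t) n_k (t)
                  + ((A (k-1) + B) / t) n_(k-1) (t) + q_k (t),
>>
    where q_k is the probability that the new vertex has degree k.  That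
    probability need not converge, which is why only bounds are available:
    q_k decays exponentially by Chernoff's bound ([newborn_le]), and q_0 is
    bounded below because of the classical rule ([newborn0_ge]).  Recursions of
    this shape transfer bounds on q_k to n_k / t ([damped_recursion_limsup],
    [damped_recursion_liminf]): by induction on k, the superior and inferior
    limits of n_k / t lie between two solutions of
<<
      (1 + A k + B) a_k = (A (k-1) + B) a_(k-1) + f_k,
>>
    one with f_k exponentially small, the other with f_k = 0 for k > 0
    ([mean_degree_count_limsup], [mean_degree_count_liminf]).

    With c = B / A and beta = 1 + 1 / A, the ratio of consecutive solutions of
    the homogeneous equation is (k - 1 + c) / (k - 1 + c + beta).  Bernoulli's
    inequality encloses it between the ratios of consecutive terms of
    (k + c)^(-beta) and of (k + c + beta - 1)^(-beta), which yields the power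
    law on both sides ([stationary_lower], [stationary_upper]).

    All this concerns a functional [law_mean] built from the transition
    probabilities alone, so that the constants depend on the parameters only.
    The process enters through [law_of_process]: its step condition, stated for
    whole histories, is summed over the past to give the Markov transition. *)

(** * Independent trials *)

Section Trials.
Context {R : realType} {I : finType}.
Implicit Types (p y z : I -> R) (S A : {set I}).

Lemma independent_trials_ge0 p S :
  (forall i, 0 <= p i <= 1) -> 0 <= independent_trials p S.
Proof.
move=> p01; apply: mulr_ge0; apply: prodr_ge0 => i _.
  by case/andP: (p01 i).
by rewrite subr_ge0; case/andP: (p01 i).
Qed.

(** Expanding the product on the right over the two outcomes of every trial
    gives the left-hand side; every moment used below is an instance. *)
Lemma sum_independent_trials p y z :
  \sum_S independent_trials p S * (\prod_(i in S) y i * \prod_(i in ~: S) z i)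
  = \prod_i (p i * y i + (1 - p i) * z i).
Proof.
rewrite bigA_distr; apply: eq_bigr => S _.
rewrite /independent_trials mulrACA -!big_split /=.
rewrite [RHS](bigID (mem S)) /=; congr (_ * _).
  by apply: eq_bigr => i ->.
by apply: eq_big => [i|i]; rewrite inE // => /negPf ->.
Qed.

Lemma independent_trials_cover p A :
  \sum_S independent_trials p S * (A \subset S)%:R = \prod_(i in A) p i.
Proof.
have := sum_independent_trials p (fun=> 1) (fun i => (i \notin A)%:R).
under [in RHS]eq_bigr => i _ do rewrite mulr1.
move=> H; transitivity (\prod_i (p i + (1 - p i) * (i \notin A)%:R)).
  rewrite -H; apply: eq_bigr => S _; congr (_ * _).
  rewrite big1 // mul1r; case: (boolP (A \subset S)) => [AS|/subsetPn[i iA iS]].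
    rewrite big1 // => i; rewrite inE => iS.
    by rewrite (contraNN (fintype.subsetP AS i) iS).
  by rewrite (bigD1 i) /= ?inE ?iS // iA mul0r.
rewrite [RHS]big_mkcond; apply: eq_bigr => i _.
by case: (i \in A); rewrite ?mulr0 ?addr0 // mulr1 subrKC.
Qed.

Lemma sum_independent_trials1 p : \sum_S independent_trials p S = 1.
Proof.
have := independent_trials_cover p finset.set0; rewrite big_set0 => <-.
by apply: eq_bigr => S _; rewrite finset.sub0set mulr1.
Qed.

Lemma independent_trials_marginal p i :
  \sum_S independent_trials p S * (i \in S)%:R = p i.
Proof.
have := independent_trials_cover p [set i]%SET; rewrite big_set1 => <-.
by apply: eq_bigr => S _; rewrite finset.sub1set.
Qed.

Lemma card_indicator S : #|S|%:R = \sum_i (i \in S)%:R :> R.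
Proof. by rewrite -sum1_card natr_sum big_mkcond; apply: eq_bigr => i _; case: ifP. Qed.

Lemma independent_trials_mean p :
  \sum_S independent_trials p S * #|S|%:R = \sum_i p i.
Proof.
under eq_bigr => S _ do rewrite card_indicator mulr_sumr.
by rewrite exchange_big; apply: eq_bigr => i _; exact: independent_trials_marginal.
Qed.

Lemma independent_trials_second_moment p : (forall i, 0 <= p i) ->
  \sum_S independent_trials p S * #|S|%:R ^+ 2
    <= \sum_i p i + (\sum_i p i) ^+ 2.
Proof.
move=> p0; rewrite expr2 mulr_suml -big_split /=.
under eq_bigr => S _ do rewrite card_indicator expr2 mulr_suml mulr_sumr.
rewrite exchange_big; apply: ler_sum => i _.
under eq_bigr => S _ do rewrite mulr_sumr mulr_sumr.
rewrite exchange_big (bigD1 i) //=.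
have -> : \sum_S independent_trials p S * ((i \in S)%:R * (i \in S)%:R) = p i.
  rewrite -[RHS](independent_trials_marginal p); apply: eq_bigr => S _.
  by case: (i \in S); rewrite ?mulr1 ?mulr0.
rewrite lerD2l mulr_sumr [leRHS](bigD1 i) //=.
apply: ler_wpDl; first by rewrite mulr_ge0.
apply: ler_sum => j ji.
have := independent_trials_cover p [set i; j]%SET.
rewrite big_setU1 ?big_set1 ?inE 1?eq_sym //= => <-.
rewrite le_eqVlt; apply/orP; left; apply/eqP; apply: eq_bigr => S _.
rewrite finset.subUset !finset.sub1set.
by case: (i \in S); case: (j \in S); rewrite ?mulr1 ?mulr0.
Qed.

(** Chernoff's bound: the generating function at x of the number of successes
    is at most exp ((x - 1) * mean). *)
Lemma independent_trials_chernoff p x k : (forall i, 0 <= p i <= 1) -> 0 < x ->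
  \sum_S independent_trials p S * (#|S| == k)%:R
    <= expR ((x - 1) * \sum_i p i) / x ^+ k.
Proof.
move=> p01 x0.
have gen : \sum_S independent_trials p S * x ^+ #|S|
    = \prod_i (p i * x + (1 - p i) * 1).
  rewrite -(sum_independent_trials p (fun=> x) (fun=> 1)).
  by apply: eq_bigr => S _; rewrite prodr_const big1 ?mulr1.
rewrite ler_pdivlMr ?exprn_gt0 //.
apply: (@le_trans _ _ (\prod_i (p i * x + (1 - p i) * 1))).
  rewrite -gen mulr_suml; apply: ler_sum => S _.
  rewrite -mulrA; apply: ler_wpM2l; first exact: independent_trials_ge0.
  by case: eqP => [->|_]; rewrite ?mul1r // mul0r exprn_ge0 // ltW.
rewrite mulr_sumr expR_sum; apply: ler_prod => i _; apply/andP; split.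
  by have /andP[a b] := p01 i; rewrite addr_ge0 ?mulr_ge0 ?subr_ge0 // ltW.
apply: le_trans (expR_ge1Dx _); rewrite le_eqVlt; apply/orP; left; apply/eqP.
by ring.
Qed.

End Trials.

(** * Adding a vertex to a graph *)

Section Extension.
Variable t : nat.
Implicit Types (g : graph t) (S : {set 'I_t.+1}).

Lemma old_vertex_inj : injective (@old_vertex t).
Proof. by move=> i j /(congr1 val) /= ij; apply: val_inj. Qed.

Lemma old_vertex_neq_new (i : 'I_t.+1) : old_vertex i != ord_max.
Proof. by rewrite -val_eqE /= neq_ltn ltn_ord. Qed.

Lemma new_vertex_notin (e : {set 'I_t.+1}) :
  (ord_max \in [set old_vertex i | i in e]%SET) = false.
Proof.
apply/negP => /imsetP[i _ /eqP].
by rewrite eq_sym (negPf (old_vertex_neq_new i)).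
Qed.

Lemma spoke_inj :
  injective (fun i : 'I_t.+1 => [set old_vertex i; ord_max]%SET).
Proof.
move=> i j /setP/(_ (old_vertex i)); rewrite !inE eqxx /=.
by rewrite (negPf (old_vertex_neq_new i)) orbF => /esym/eqP/old_vertex_inj.
Qed.

Lemma sum_extend g S (F : {set 'I_t.+2} -> nat) :
  (\sum_(e in extend g S) F e
   = \sum_(e in g) F [set old_vertex i | i in e]%SET
     + \sum_(i in S) F [set old_vertex i; ord_max]%SET)%N.
Proof.
pose old : {set {set 'I_t.+2}} :=
  [set [set old_vertex i | i in e] | e : {set 'I_t.+1} in g]%SET.
pose new := [set [set old_vertex i; ord_max] | i in S]%SET.
transitivity (\sum_(e in [predU old & new]) F e)%N.
  by apply: eq_bigl => e; rewrite !inE.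
rewrite bigU /=; last first.
  rewrite -setI_eq0; apply/eqP/setP => e; rewrite !inE; apply/negP.
  case/andP => /imsetP[f _ ->] /imsetP[i _] /setP/(_ ord_max).
  by rewrite new_vertex_notin !inE eqxx orbT.
congr (_ + _)%N.
  rewrite big_imset //= => e f _ _.
  by apply: imset_inj; exact: old_vertex_inj.
by rewrite big_imset //= => i j _ _; exact: spoke_inj.
Qed.

Lemma degree_sum n (g : graph n) i : degree g i = (\sum_(e in g) (i \in e))%N.
Proof.
by rewrite /degree -sum1_card [RHS]big_mkcond [LHS]big_mkcond; apply: eq_bigr => e _;
  rewrite !inE; case: (e \in g); case: (i \in e).
Qed.

Lemma num_edges_extend g S : num_edges (extend g S) = (num_edges g + #|S|)%N.
Proof.
rewrite /num_edges -sum1_card (sum_extend g S (fun=> 1%N)).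
by rewrite !sum1_card.
Qed.

Lemma degree_extend_old g S i :
  degree (extend g S) (old_vertex i) = (degree g i + (i \in S))%N.
Proof.
rewrite !degree_sum sum_extend; congr (_ + _)%N.
  by apply: eq_bigr => e _; rewrite mem_imset //; exact: old_vertex_inj.
transitivity (\sum_(j in S) (j == i))%N.
  apply: eq_bigr => j _; rewrite !inE (negPf (old_vertex_neq_new i)) orbF.
  by rewrite (inj_eq old_vertex_inj) eq_sym.
case: (boolP (i \in S)) => iS.
  by rewrite (bigD1 i) //= eqxx big1 // => j /andP[_ /negPf ->].
by rewrite big1 // => j jS; case: eqP => // ji; rewrite ji (negPf iS) in jS.
Qed.

Lemma degree_extend_new g S : degree (extend g S) ord_max = #|S|.
Proof.
rewrite degree_sum sum_extend big1 => [|e _]; last by rewrite new_vertex_notin.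
by rewrite add0n -sum1_card; apply: eq_bigr => i _; rewrite !inE eqxx orbT.
Qed.

Lemma num_degree_sum n (g : graph n) k :
  num_degree k g = (\sum_i (degree g i == k))%N.
Proof.
rewrite /num_degree -sum1_card big_mkcond; apply: eq_bigr => i _.
by rewrite inE; case: eqP.
Qed.

Lemma num_degree_extend g S k :
  num_degree k (extend g S)
  = ((\sum_i (degree g i + (i \in S) == k)) + (#|S| == k))%N.
Proof.
rewrite num_degree_sum big_ord_recr /= degree_extend_new; congr (_ + _)%N.
apply: eq_bigr => i _; rewrite -degree_extend_old.
by congr (nat_of_bool (degree _ _ == _)); apply: val_inj.
Qed.

Lemma extend_inj g : injective (extend g).
Proof.
move=> S1 S2 E; apply/setP => i.
have := degree_extend_old g S1 i; rewrite E degree_extend_old.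
by move/eqP; rewrite eqn_add2l; case: (i \in S1); case: (i \in S2).
Qed.

Lemma degree_le_num_edges n (g : graph n) i : (degree g i <= num_edges g)%N.
Proof. by apply: subset_leq_card; apply/fintype.subsetP => e; rewrite inE => /andP[]. Qed.

Lemma num_degree_le n (g : graph n) k : (num_degree k g <= n.+1)%N.
Proof. by rewrite -[leqRHS]card_ord; exact: max_card. Qed.

End Extension.

(** Holds of every graph that the process visits.  The size of the edges gives
    the handshake identity; one edge is enough to make the denominators of the
    preferential rule nonzero. *)
Definition proper_graph t (g : graph t) : bool :=
  (0 < num_edges g)%N && [forall e in g, #|e : {set 'I_t.+1}| == 2%N].

Lemma proper_initial : proper_graph initial_graph.
Proof.
apply/andP; split; first by rewrite /num_edges cards1.
by apply/forall_inP => e; rewrite inE => /eqP ->; rewrite cards2.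
Qed.

Lemma proper_extend t (g : graph t) S :
  proper_graph g -> proper_graph (extend g S).
Proof.
case/andP => g0 /forall_inP g2; apply/andP; split.
  by rewrite num_edges_extend ltn_addr.
apply/forall_inP => e; rewrite inE => /orP[] /imsetP[x xg ->].
  by rewrite card_imset ?g2 //; exact: old_vertex_inj.
by rewrite cards2 old_vertex_neq_new.
Qed.

Lemma handshake t (g : graph t) : proper_graph g ->
  (\sum_i degree g i = 2 * num_edges g)%N.
Proof.
case/andP => _ /forall_inP g2; under eq_bigr => i _ do rewrite degree_sum.
rewrite exchange_big /= mulnC -sum_nat_const; apply: eq_bigr => e /g2/eqP <-.
by rewrite -sum1_card big_mkcond [RHS]big_mkcond; apply: eq_bigr => i _; case: ifP.
Qed.

(** The vertices of degree k alone contribute k times their number to the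
    handshake sum. *)
Lemma num_degree_mul_le t (g : graph t) k : proper_graph g ->
  (k * num_degree k g <= 2 * num_edges g)%N.
Proof.
move=> pg; rewrite -handshake // num_degree_sum big_distrr /=.
by apply: leq_sum => i _; case: eqP => [->|]; rewrite ?muln1 ?muln0.
Qed.

(** * One step of the process *)

Section Step.
Context {R : realType}.
Variables alpha mu zeta : R.
Hypotheses (alpha01 : 0 < alpha < 1) (mu02 : 0 < mu <= 2) (zeta0 : 0 < zeta).

Let alpha_ge0 : 0 <= alpha. Proof. by case/andP: alpha01 => /ltW. Qed.
Let calpha_ge0 : 0 <= 1 - alpha.
Proof. by rewrite subr_ge0; case/andP: alpha01 => _ /ltW. Qed.
Let mu_gt0 : 0 < mu. Proof. by case/andP: mu02. Qed.

Lemma classical_prob01 t (i : 'I_t.+1) : 0 <= classical_prob zeta i <= 1.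
Proof.
rewrite /classical_prob ler_pdivrMr ?ltr0n // mul1r ge_min lexx orbT andbT.
by apply: divr_ge0 => //; rewrite le_min ltW //=.
Qed.

Lemma sum_classical_prob t : \sum_i @classical_prob R zeta t i = Num.min zeta t.+1%:R.
Proof.
by rewrite sumr_const card_ord -[LHS]mulr_natr divfK.
Qed.

Lemma pref_prob01 t (g : graph t) i : 0 <= pref_prob mu g i <= 1.
Proof.
rewrite /pref_prob ge_min lexx orbT andbT le_min ler01 andbT.
by apply: divr_ge0 => //; apply: mulr_ge0 => //; exact: ltW.
Qed.

(** The hypothesis mu <= 2 serves here: a vertex has at most as many edges as
    the graph, so the truncation at 1 never takes effect. *)
Lemma pref_probE t (g : graph t) i : proper_graph g ->
  pref_prob mu g i = mu * (degree g i)%:R / (2 * (num_edges g)%:R).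
Proof.
case/andP => e0 _; rewrite /pref_prob min_l //.
rewrite ler_pdivrMr ?mulr_gt0 ?ltr0n // mul1r.
apply: ler_pM => //; first exact: ltW.
  by case/andP: mu02.
by rewrite ler_nat degree_le_num_edges.
Qed.

Lemma sum_pref_prob t (g : graph t) : proper_graph g ->
  \sum_i pref_prob mu g i = mu.
Proof.
move=> pg; under eq_bigr => i _ do rewrite pref_probE //.
rewrite -mulr_suml -mulr_sumr -natr_sum handshake // natrM mulfK //.
by case/andP: pg => e0 _; rewrite mulf_neq0 // pnatr_eq0 // -lt0n.
Qed.

Definition attach_mean t (g : graph t) (F : {set 'I_t.+1} -> R) : R :=
  \sum_S attach_prob alpha mu zeta g S * F S.

Lemma attach_meanE t (g : graph t) F :
  attach_mean g F
  = alpha * (\sum_S independent_trials (pref_prob mu g) S * F S)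
    + (1 - alpha) * (\sum_S independent_trials (@classical_prob R zeta t) S * F S).
Proof.
rewrite !mulr_sumr -big_split; apply: eq_bigr => S _ /=.
by rewrite /attach_prob mulrDl !mulrA.
Qed.

Lemma attach_prob_ge0 t (g : graph t) S : 0 <= attach_prob alpha mu zeta g S.
Proof.
apply: addr_ge0; apply: mulr_ge0 => //; apply: independent_trials_ge0.
  exact: pref_prob01.
exact: classical_prob01.
Qed.

Lemma attach_mean_le t (g : graph t) F F' :
  (forall S, F S <= F' S) -> attach_mean g F <= attach_mean g F'.
Proof.
by move=> FF'; apply: ler_sum => S _; apply: ler_wpM2l => //; exact: attach_prob_ge0.
Qed.

Lemma attach_mean_linear t (g : graph t) (a : R) F F' :
  attach_mean g (fun S => a * F S + F' S) = a * attach_mean g F + attach_mean g F'.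
Proof.
by rewrite mulr_sumr -big_split; apply: eq_bigr => S _ /=; rewrite mulrDr mulrCA.
Qed.

Lemma attach_mean1 t (g : graph t) : attach_mean g (fun=> 1) = 1.
Proof.
have tot (p : 'I_t.+1 -> R) : \sum_S independent_trials p S * 1 = 1.
  by under eq_bigr => S _ do rewrite mulr1; exact: sum_independent_trials1.
by rewrite attach_meanE !tot !mulr1 subrKC.
Qed.

Lemma attach_mean_cst t (g : graph t) a : attach_mean g (fun=> a) = a.
Proof.
have := attach_mean_linear g a (fun=> 1) (fun=> 0).
rewrite attach_mean1 mulr1 [X in _ = _ + X]big1 => [|S _]; last exact: mulr0.
by rewrite !addr0.
Qed.

Definition mean_new_edges : R := alpha * mu + (1 - alpha) * zeta.
Definition new_edges_bound : R :=
  alpha * (mu + mu ^+ 2) + (1 - alpha) * (zeta + zeta ^+ 2).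

Lemma attach_mean_card t (g : graph t) : proper_graph g -> zeta <= t.+1%:R ->
  attach_mean g (fun S => #|S|%:R) = mean_new_edges.
Proof.
move=> pg zt; rewrite attach_meanE !independent_trials_mean sum_pref_prob //.
by rewrite sum_classical_prob min_l.
Qed.

Lemma attach_mean_card_sq t (g : graph t) : proper_graph g -> zeta <= t.+1%:R ->
  attach_mean g (fun S => #|S|%:R ^+ 2) <= new_edges_bound.
Proof.
move=> pg zt; rewrite attach_meanE; apply: lerD; apply: ler_wpM2l => //.
  apply: le_trans (independent_trials_second_moment _) _ => [i|].
    by case/andP: (pref_prob01 g i).
  by rewrite sum_pref_prob.
apply: le_trans (independent_trials_second_moment _) _ => [i|].
  by case/andP: (classical_prob01 i).
by rewrite sum_classical_prob min_l.
Qed.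

(** The compensated number of edges is a martingale once t + 1 >= zeta, so its
    second moment grows by the conditional variance only. *)
Lemma attach_mean_edges_sq t (g : graph t) : proper_graph g -> zeta <= t.+1%:R ->
  attach_mean g
    (fun S => ((num_edges (extend g S))%:R - mean_new_edges * t.+1%:R) ^+ 2)
  <= ((num_edges g)%:R - mean_new_edges * t%:R) ^+ 2 + new_edges_bound.
Proof.
move=> pg zt; set m := mean_new_edges; set x := _ - m * t%:R.
pose F (S : {set 'I_t.+1}) : R := 2 * (x - m) * #|S|%:R + (x - m) ^+ 2.
have -> : attach_mean g
    (fun S => ((num_edges (extend g S))%:R - m * t.+1%:R) ^+ 2)
  = attach_mean g (fun S => 1 * #|S|%:R ^+ 2 + F S).
  apply: eq_bigr => S _; congr (_ * _).
  by rewrite num_edges_extend natrD -natr1 /F /x; ring.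
rewrite attach_mean_linear attach_mean_linear attach_mean_cst attach_mean_card //.
rewrite -/m mul1r; have := attach_mean_card_sq pg zt.
move: (attach_mean g _) => y hy.
have -> : y + (2 * (x - m) * m + (x - m) ^+ 2) = x ^+ 2 + y - m ^+ 2 by ring.
by have := sqr_ge0 m; lra.
Qed.

Definition edge_gain_prob t (g : graph t) (k : nat) : R :=
  alpha * (mu * k%:R / (2 * (num_edges g)%:R))
  + (1 - alpha) * (Num.min zeta t.+1%:R / t.+1%:R).

Lemma attach_mean_mem t (g : graph t) i : proper_graph g ->
  attach_mean g (fun S => (i \in S)%:R) = edge_gain_prob g (degree g i).
Proof.
by move=> pg; rewrite attach_meanE !independent_trials_marginal pref_probE.
Qed.

Definition newborn_degree_prob t (g : graph t) (k : nat) : R :=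
  attach_mean g (fun S => (#|S| == k)%:R).

Lemma newborn_ge0 t (g : graph t) k : 0 <= newborn_degree_prob g k.
Proof.
by apply: sumr_ge0 => S _; rewrite mulr_ge0 ?attach_prob_ge0.
Qed.

(** Chernoff's bound at x = exp 2.  The decay exp (- 2 k) leaves room for the
    factor exp k that will dominate a power of k. *)
Definition newborn_bound (k : nat) : R :=
  expR ((expR 2 - 1) * (mu + zeta)) * expR (- 2) ^+ k.

Lemma newborn_le t (g : graph t) k : proper_graph g ->
  newborn_degree_prob g k <= newborn_bound k.
Proof.
move=> pg; rewrite /newborn_degree_prob attach_meanE.
have e1 : 0 <= expR 2 - 1 :> R by rewrite subr_ge0 ltW // expR_gt1.
have bound (p : 'I_t.+1 -> R) : (forall i, 0 <= p i <= 1) ->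
    \sum_i p i <= mu + zeta ->
    \sum_S independent_trials p S * (#|S| == k)%:R <= newborn_bound k.
  move=> p01 pm; have := independent_trials_chernoff k p01 (expR_gt0 2).
  move=> /le_trans; apply; rewrite /newborn_bound expRN exprVn.
  by rewrite ler_pM2r ?invr_gt0 ?exprn_gt0 ?expR_gt0 // ler_expR ler_wpM2l.
have -> : newborn_bound k = alpha * newborn_bound k + (1 - alpha) * newborn_bound k.
  by ring.
apply: lerD; apply: ler_wpM2l => //; apply: bound.
- exact: pref_prob01.
- by rewrite sum_pref_prob // lerDl ltW.
- exact: classical_prob01.
- by rewrite sum_classical_prob ge_min lerDr ltW.
Qed.

(** Under the classical rule the new vertex is isolated with probability
    (1 - zeta / n) ^ n, where n = t + 1; this is at least exp (- 2 zeta) once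
    zeta / n <= 1 / 2. *)
Lemma newborn0_ge t (g : graph t) : 2 * zeta <= t.+1%:R ->
  (1 - alpha) * expR (- (2 * zeta)) <= newborn_degree_prob g 0.
Proof.
move=> zt; rewrite /newborn_degree_prob attach_meanE.
apply: ler_wpDl.
  apply: mulr_ge0 => //; apply: sumr_ge0 => S _; apply: mulr_ge0 => //.
  exact/independent_trials_ge0/pref_prob01.
apply: ler_wpM2l => //.
rewrite (bigD1 finset.set0) //= big1 => [|S S0]; last first.
  by rewrite cards_eq0 (negPf S0) mulr0.
rewrite cards0 eqxx mulr1 addr0 /independent_trials big_set0 mul1r.
rewrite finset.setC0.
have n0 : 0 < t.+1%:R :> R by rewrite ltr0n.
have zle : zeta <= t.+1%:R by lra.
pose x := zeta / t.+1%:R.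
have x0 : 0 < x by rewrite divr_gt0.
have x2 : x <= 2^-1 by rewrite ler_pdivrMr //; lra.
rewrite (eq_bigr (fun=> 1 - x)) => [|i _]; last by rewrite /classical_prob min_l.
rewrite prodr_const cardsT card_ord.
have -> : - (2 * zeta) = t.+1%:R * (- (2 * x)) by rewrite /x; field; exact: lt0r_neq0.
rewrite expRM_natl; apply: lerXn2r; rewrite ?nnegrE ?expR_ge0 //; first by lra.
rewrite expRN -[leRHS]invrK lef_pV2 ?posrE ?invr_gt0 ?expR_gt0 //; last by lra.
apply: le_trans (expR_ge1Dx _).
rewrite -[leLHS]mul1r ler_pdivrMr; last by lra.
by nra.
Qed.

Let num_degreeR t (g : graph t) k :
  (num_degree k g)%:R = \sum_i (degree g i == k)%:R :> R.
Proof. by rewrite num_degree_sum natr_sum. Qed.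

Lemma attach_mean_sum t (g : graph t) (J : finType) (F : J -> {set 'I_t.+1} -> R) :
  attach_mean g (fun S => \sum_j F j S) = \sum_j attach_mean g (F j).
Proof.
rewrite exchange_big; apply: eq_bigr => S _ /=.
by rewrite mulr_sumr.
Qed.

Lemma attach_mean_num_degree0 t (g : graph t) : proper_graph g ->
  attach_mean g (fun S => (num_degree 0 (extend g S))%:R)
  = (num_degree 0 g)%:R * (1 - edge_gain_prob g 0) + newborn_degree_prob g 0.
Proof.
move=> pg.
pose F i (S : {set 'I_t.+1}) : R := (degree g i == 0%N)%:R * (1 - (i \in S)%:R).
transitivity (attach_mean g (fun S => 1 * (\sum_i F i S) + (#|S| == 0%N)%:R)).
  apply: eq_bigr => S _; congr (_ * _).
  rewrite num_degree_extend natrD natr_sum mul1r; congr (_ + _).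
  apply: eq_bigr => i _; rewrite /F addn_eq0 eqb0.
  by case: (degree g i == 0%N); case: (i \in S); rewrite /= ?subrr ?subr0 ?mulr1 ?mul0r ?mulr0.
rewrite attach_mean_linear mul1r attach_mean_sum num_degreeR mulr_suml.
congr (_ + _); apply: eq_bigr => i _.
transitivity (attach_mean g (fun S => - (degree g i == 0%N)%:R * (i \in S)%:R
                                      + (degree g i == 0%N)%:R)).
  by apply: eq_bigr => S _; congr (_ * _); rewrite /F; ring.
rewrite attach_mean_linear attach_mean_cst attach_mean_mem //.
by case: eqP => [->|_] /=; ring.
Qed.

Lemma attach_mean_num_degreeS t (g : graph t) k : proper_graph g ->
  attach_mean g (fun S => (num_degree k.+1 (extend g S))%:R)
  = (num_degree k.+1 g)%:R * (1 - edge_gain_prob g k.+1)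
    + (num_degree k g)%:R * edge_gain_prob g k + newborn_degree_prob g k.+1.
Proof.
move=> pg.
pose F i (S : {set 'I_t.+1}) : R := 
  ((degree g i == k)%:R - (degree g i == k.+1)%:R) * (i \in S)%:R
  + (degree g i == k.+1)%:R.
transitivity (attach_mean g (fun S => 1 * (\sum_i F i S) + (#|S| == k.+1)%:R)).
  apply: eq_bigr => S _; congr (_ * _).
  rewrite num_degree_extend natrD natr_sum mul1r; congr (_ + _).
  apply: eq_bigr => i _; rewrite /F; case: (i \in S).
    by rewrite addn1 eqSS mulr1 subrK.
  by rewrite addn0 mulr0 add0r.
rewrite attach_mean_linear mul1r attach_mean_sum !num_degreeR !mulr_suml -big_split.
congr (_ + _); apply: eq_bigr => i _ /=.
rewrite attach_mean_linear attach_mean_cst attach_mean_mem //.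
case: (eqVneq (degree g i) k) => [->|_]; first by rewrite ltn_eqF //=; ring.
by case: eqP => [->|_] /=; ring.
Qed.

End Step.

(** * The law of the process *)

Section LawMean.
Local Open Scope classical_set_scope.
Local Open Scope ring_scope.
Context {R : realType}.
Variables alpha mu zeta : R.

(** Expectation of f at time n + 1, the first time being 1: averaging over the
    last arrival turns f into a function of the graph one step before. *)
Fixpoint law_mean (n : nat) : (graph n.+1 -> R) -> R :=
  if n is n'.+1 then fun f =>
    @law_mean n' (fun g => attach_mean alpha mu zeta g (fun S => f (extend g S)))
  else fun f => f initial_graph.

Lemma law_meanS n (f : graph n.+2 -> R) :
  law_mean f
  = law_mean (fun g => attach_mean alpha mu zeta g (fun S => f (extend g S))).
Proof. by []. Qed.

Lemma law_mean_linear n (a : R) (f f' : graph n.+1 -> R) :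
  law_mean (fun g => a * f g + f' g) = a * law_mean f + law_mean f'.
Proof.
elim: n f f' => [//|n IH] f f' /=; rewrite -IH; congr law_mean.
by apply/funext => g; exact: attach_mean_linear.
Qed.

Lemma law_meanD n (f f' : graph n.+1 -> R) :
  law_mean (fun g => f g + f' g) = law_mean f + law_mean f'.
Proof.
rewrite -[law_mean f]mul1r -law_mean_linear; congr law_mean.
by apply/funext => g; rewrite mul1r.
Qed.

Lemma law_mean_cst n (a : R) : law_mean (fun _ : graph n.+1 => a) = a.
Proof.
elim: n => [//|n IH] /=; rewrite -[RHS]IH; congr law_mean.
by apply/funext => g; exact: attach_mean_cst.
Qed.

Lemma law_meanZ n (a : R) (f : graph n.+1 -> R) :
  law_mean (fun g => a * f g) = a * law_mean f.
Proof.
rewrite -[RHS]addr0 -[in RHS](law_mean_cst n 0) -law_mean_linear.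
by congr law_mean; apply/funext => g; rewrite addr0.
Qed.

Hypotheses (alpha01 : 0 < alpha < 1) (mu02 : 0 < mu <= 2) (zeta0 : 0 < zeta).

Lemma law_mean_le n (f f' : graph n.+1 -> R) :
  (forall g, proper_graph g -> f g <= f' g) -> law_mean f <= law_mean f'.
Proof.
elim: n f f' => [|n IH] f f' ff' /=; first exact/ff'/proper_initial.
apply: IH => g pg; apply: attach_mean_le => // S.
exact/ff'/proper_extend.
Qed.

Let m := mean_new_edges alpha mu zeta.

Let m_gt0 : 0 < m.
Proof.
case/andP: alpha01 => a0 a1; case/andP: mu02 => mu0 _.
by rewrite /m /mean_new_edges addr_gt0 // mulr_gt0 // subr_gt0.
Qed.

Definition edge_deviation (n : nat) : R :=
  law_mean (fun g : graph n.+1 => `|(num_edges g)%:R - m * n.+1%:R|).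

Lemma edge_variance_bound : exists K : R, \forall n \near \oo,
  law_mean (fun g : graph n.+1 => ((num_edges g)%:R - m * n.+1%:R) ^+ 2)
    <= K * n.+1%:R.
Proof.
pose Y n := law_mean (fun g : graph n.+1 => ((num_edges g)%:R - m * n.+1%:R) ^+ 2).
pose v := new_edges_bound alpha mu zeta.
have Y0 n : 0 <= Y n.
  rewrite -[leLHS](law_mean_cst n 0); apply: law_mean_le => g _; exact: sqr_ge0.
have v0 : 0 <= v.
  case/andP: alpha01 => a0 a1; case/andP: mu02 => mu0 _; rewrite /v /new_edges_bound.
  by apply: addr_ge0; apply: mulr_ge0; rewrite ?subr_ge0 ?addr_ge0 ?sqr_ge0 // ltW.
have [N _ HN] : \forall n \near \oo, zeta <= n%:R by exact: nbhs_infty_ger.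
have step n : (N <= n)%N -> Y n.+1 <= Y n + v.
  move=> Nn; rewrite -[v](law_mean_cst n) /Y -law_meanD law_meanS; apply: law_mean_le => g pg.
  apply: attach_mean_edges_sq => //; apply: HN => /=.
  by rewrite (leq_trans Nn) // ltnW.
clearbody v.
have bound j : Y (N + j)%N <= Y N + v * j%:R.
  elim: j => [|j IH]; first by rewrite addn0 mulr0 addr0.
  rewrite addnS; apply: le_trans (step _ (leq_addr _ _)) _.
  by rewrite -(natr1 j); lra.
exists (Y N + v); exists N => // n /= Nn.
have := bound (n - N)%N; rewrite subnKC // => /le_trans; apply.
rewrite mulrDl; apply: lerD.
  by rewrite ler_peMr // ler1n.
by rewrite ler_wpM2l // ler_nat; lia.
Qed.

(** The variance grows linearly, so the deviation is of order sqrt t; the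
    inequality 2 |x| <= d t + x ^ 2 / (d t) replaces Cauchy-Schwarz. *)
Lemma edge_deviation_small (eps : R) : 0 < eps ->
  \forall n \near \oo, edge_deviation n <= eps * n.+1%:R.
Proof.
move=> eps0; have [K HK] := edge_variance_bound.
near=> n.
have var : law_mean (fun g : graph n.+1 => ((num_edges g)%:R - m * n.+1%:R) ^+ 2)
    <= K * n.+1%:R by near: n.
have Kn : K / eps ^+ 2 <= n.+1%:R.
  apply: (@le_trans _ _ n%:R); last by rewrite ler_nat.
  by near: n; exact: nbhs_infty_ger.
have t0 : 0 < n.+1%:R :> R by rewrite ltr0n.
rewrite /edge_deviation; move: (n.+1%:R : R) t0 Kn var => t t0 Kn var.
have et0 : 0 < eps * t by exact: mulr_gt0.
have Kt : K <= eps ^+ 2 * t by rewrite mulrC -ler_pdivrMr ?exprn_gt0.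
apply: (@le_trans _ _ (law_mean (fun g : graph n.+1 =>
    (2 * (eps * t))^-1 * ((num_edges g)%:R - m * t) ^+ 2 + eps * t / 2))).
  apply: law_mean_le => g _; move: (_ - m * t) => x.
  rewrite -subr_ge0.
  have -> : (2 * (eps * t))^-1 * x ^+ 2 + eps * t / 2 - `|x|
      = (2 * (eps * t))^-1 * (`|x| - eps * t) ^+ 2.
    rewrite sqrrB real_normK ?num_real //; field.
    by rewrite !lt0r_neq0.
  by rewrite mulr_ge0 ?sqr_ge0 // invr_ge0 mulr_ge0 // ltW.
rewrite law_mean_linear law_mean_cst.
rewrite [leRHS](_ : _ = eps * t / 2 + eps * t / 2); last by field.
rewrite lerD2r mulrC ler_pdivrMr ?mulr_gt0 //.
apply: (le_trans var); rewrite [leRHS](_ : _ = eps ^+ 2 * t * t); last by field.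
by rewrite ler_pM2r.
Unshelve. all: by end_near. Qed.

(** In the limit a vertex of degree k gains edges at rate [gain_rate k] / t. *)
Definition gain_rate (k : nat) : R :=
  alpha * mu / (2 * m) * k%:R + (1 - alpha) * zeta.

Lemma gain_rate_ge0 k : 0 <= gain_rate k.
Proof.
case/andP: alpha01 => a0 a1; case/andP: mu02 => mu0 _.
by rewrite addr_ge0 // ?mulr_ge0 ?invr_ge0 ?mulr_ge0 ?subr_ge0 // ltW.
Qed.

Definition gain_error n (g : graph n.+1) : R :=
  alpha * mu / (m * n.+1%:R) * `|(num_edges g)%:R - m * n.+1%:R|
  + (1 - alpha) * zeta / n.+1%:R.

(** The factor [num_degree k g] makes the error uniform in k, as
    k * N_k <= 2 e whatever k is. *)
Lemma gain_approx n (g : graph n.+1) k : proper_graph g -> zeta <= n.+2%:R ->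
  `|(num_degree k g)%:R * edge_gain_prob alpha mu zeta g k
    - gain_rate k / n.+1%:R * (num_degree k g)%:R| <= gain_error g.
Proof.
move=> pg zn; case/andP: alpha01 => a0 a1; case/andP: (mu02) => mu0 _.
have ca0 : 0 < 1 - alpha by rewrite subr_gt0.
rewrite /edge_gain_prob min_l // /gain_rate /gain_error.
have kN := num_degree_mul_le k pg.
have Nn := num_degree_le g k.
have e0 : (0 < num_edges g)%N by case/andP: pg.
set N : R := (num_degree k g)%:R; set e : R := (num_edges g)%:R.
have {}kN : k%:R * N <= 2 * e by rewrite -!natrM ler_nat.
have {}e0 : 0 < e by rewrite ltr0n.
have Nt2 : N <= n.+2%:R by rewrite ler_nat.
have -> : n.+2%:R = n.+1%:R + 1 :> R by rewrite natr1.
have {}Nt2 : N <= n.+1%:R + 1 by rewrite natr1.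
have N0 : 0 <= N by [].
have t0 : 0 < n.+1%:R :> R by rewrite ltr0n.
move: (n.+1%:R : R) t0 Nt2 => t t0 Nt2.
have t10 : 0 < t + 1 by rewrite addr_gt0.
have k0 : 0 <= k%:R :> R by [].
move: (k%:R : R) k0 kN => x x0 xN.
(* In the first term x * N / (2 * e) is at most 1, in the second N / (t + 1). *)
rewrite (_ : _ - _ = alpha * mu / (m * t) * ((m * t - e) * (x * N / (2 * e)))
   - (1 - alpha) * zeta / t * (N / (t + 1))); last first.
  by field; rewrite !lt0r_neq0.
apply: (le_trans (ler_normB _ _)); rewrite !normrM; apply: lerD.
  have am : 0 <= alpha * mu / (m * t).
    by apply: divr_ge0; apply: mulr_ge0; exact: ltW.
  rewrite -!normrM ![`|alpha * _ / _ * _|]normrM ger0_norm //.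
  apply: ler_wpM2l => //; rewrite normrM distrC ler_piMr //.
  rewrite ger0_norm ?ler_pdivrMr ?mulr_gt0 ?mul1r //.
  by apply: divr_ge0; apply: mulr_ge0 => //; exact: ltW.
have cz : 0 <= (1 - alpha) * zeta / t.
  by apply: divr_ge0; [apply: mulr_ge0|]; exact: ltW.
rewrite -!normrM ![`|(1 - alpha) * _ / _ * _|]normrM ger0_norm //.
rewrite ler_piMr // ger0_norm ?ler_pdivrMr ?mul1r //.
by apply: divr_ge0 => //; exact: ltW.
Qed.

Lemma gain_error_small (eps : R) : 0 < eps ->
  \forall n \near \oo, law_mean (@gain_error n) <= eps.
Proof.
move=> eps0; case/andP: (alpha01) => a0 a1; case/andP: (mu02) => mu0 _.
have am : 0 < alpha * mu by exact: mulr_gt0.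
pose d := eps / 2 * m / (alpha * mu).
have d0 : 0 < d by rewrite divr_gt0 ?mulr_gt0 // divr_gt0.
near=> n; have t0 : 0 < n.+1%:R :> R by rewrite ltr0n.
rewrite /gain_error law_mean_linear law_mean_cst.
have -> : eps = alpha * mu / (m * n.+1%:R) * (d * n.+1%:R) + eps / 2.
  by rewrite /d; field; rewrite !lt0r_neq0.
apply: lerD.
  apply: ler_wpM2l; first by apply: divr_ge0; rewrite ?mulr_ge0 // ltW.
  by near: n; exact: edge_deviation_small.
rewrite ler_pdivrMr // [leRHS]mulrC -ler_pdivrMr ?divr_gt0 //.
apply: (@le_trans _ _ n%:R); last by rewrite ler_nat.
by near: n; exact: nbhs_infty_ger.
Unshelve. all: by end_near. Qed.

(** Index n stands for time n + 1, at which there are n + 2 vertices. *)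
Definition mean_degree_count (k n : nat) : R :=
  law_mean (fun g : graph n.+1 => (num_degree k g)%:R).

Lemma mean_degree_count0_ge n : 2 * zeta <= n.+2%:R ->
  (1 - gain_rate 0 / n.+1%:R) * mean_degree_count 0 n
    + (1 - alpha) * expR (- (2 * zeta)) - law_mean (@gain_error n)
  <= mean_degree_count 0 n.+1.
Proof.
move=> zn; rewrite lerBlDr /mean_degree_count law_meanS.
rewrite -law_meanD -[X in _ + X <= _](law_mean_cst n) -law_mean_linear.
apply: law_mean_le => g pg; rewrite attach_mean_num_degree0 //.
have zn1 : zeta <= n.+2%:R by apply: le_trans zn; rewrite ler_peMl ?ler1n ?(ltW zeta0).
have := gain_approx 0 pg zn1; have := newborn0_ge alpha01 mu02 zeta0 g zn.
move: (gain_rate 0 / _) ((num_degree 0 g)%:R : R).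
move: (newborn_degree_prob _ _ _ _ _) (edge_gain_prob _ _ _ _ _).
by move=> b G r N; move: (expR _) => E; rewrite ler_norml => nb /andP[_ h]; lra.
Qed.

Lemma mean_degree_count0_le n : zeta <= n.+2%:R ->
  mean_degree_count 0 n.+1
  <= (1 - gain_rate 0 / n.+1%:R) * mean_degree_count 0 n
     + newborn_bound mu zeta 0 + law_mean (@gain_error n).
Proof.
move=> zn; rewrite /mean_degree_count law_meanS.
rewrite -[X in _ <= _ + X + _](law_mean_cst n) -law_mean_linear -law_meanD.
apply: law_mean_le => g pg; rewrite attach_mean_num_degree0 //.
have := gain_approx 0 pg zn; have := newborn_le alpha01 mu02 zeta0 0 pg.
move: (gain_rate 0 / _) ((num_degree 0 g)%:R : R).
move: (newborn_degree_prob _ _ _ _ _) (edge_gain_prob _ _ _ _ _).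
by move=> b G r N; rewrite ler_norml => nb /andP[h _]; lra.
Qed.

Lemma mean_degree_countS_ge k n : zeta <= n.+2%:R ->
  (1 - gain_rate k.+1 / n.+1%:R) * mean_degree_count k.+1 n
    + gain_rate k / n.+1%:R * mean_degree_count k n - 2 * law_mean (@gain_error n)
  <= mean_degree_count k.+1 n.+1.
Proof.
move=> zn; rewrite lerBlDr /mean_degree_count law_meanS addrC.
rewrite -!law_meanZ -!law_meanD.
apply: law_mean_le => g pg; rewrite attach_mean_num_degreeS //.
have := gain_approx k pg zn; have := gain_approx k.+1 pg zn.
have := newborn_ge0 alpha01 mu02 zeta0 g k.+1.
move: (gain_rate k / _) (gain_rate k.+1 / _) ((num_degree k g)%:R : R).
move: ((num_degree k.+1 g)%:R : R) (edge_gain_prob _ _ _ _ k) (edge_gain_prob _ _ _ _ k.+1).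
move: (newborn_degree_prob _ _ _ _ _) => b N' G G' r r' N.
by rewrite !ler_norml => nb /andP[h1 h2] /andP[h3 h4]; lra.
Qed.

Lemma mean_degree_countS_le k n : zeta <= n.+2%:R ->
  mean_degree_count k.+1 n.+1
  <= (1 - gain_rate k.+1 / n.+1%:R) * mean_degree_count k.+1 n
     + gain_rate k / n.+1%:R * mean_degree_count k n + newborn_bound mu zeta k.+1
     + 2 * law_mean (@gain_error n).
Proof.
move=> zn; rewrite /mean_degree_count law_meanS.
rewrite -[X in _ <= _ + X + _](law_mean_cst n) -!law_meanZ -!law_meanD.
apply: law_mean_le => g pg; rewrite attach_mean_num_degreeS //.
have := gain_approx k pg zn; have := gain_approx k.+1 pg zn.
have := newborn_le alpha01 mu02 zeta0 k.+1 pg.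
move: (gain_rate k / _) (gain_rate k.+1 / _) ((num_degree k g)%:R : R).
move: ((num_degree k.+1 g)%:R : R) (edge_gain_prob _ _ _ _ k) (edge_gain_prob _ _ _ _ k.+1).
move: (newborn_degree_prob _ _ _ _ _) => b N' G G' r r' N.
by rewrite !ler_norml => nb /andP[h1 h2] /andP[h3 h4]; lra.
Qed.

End LawMean.

(** * Linear recursions with 1 / t damping *)

Section Recursion.
Local Open Scope classical_set_scope.
Local Open Scope ring_scope.
Context {R : realType}.
Implicit Types (u : nat -> R) (c rho eps : R).

(** The excess of u over the particular solution (rho / (1 + c)) t satisfies the
    homogeneous recursion, whose factor lies in [0, 1] once t >= c: so the
    excess stays bounded above. *)
Lemma damped_recursion_upper u c rho : 0 <= c ->
  (\forall n \near \oo, u n.+1 <= (1 - c / n.+1%:R) * u n + rho) ->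
  forall eps, 0 < eps ->
    \forall n \near \oo, u n <= (rho / (1 + c) + eps) * n.+1%:R.
Proof.
move=> c0 [N1 _ rec] eps eps0.
have [N2 _ HN2] : \forall n \near \oo, c <= n%:R by exact: nbhs_infty_ger.
pose N := maxn N1 N2; pose y n := u n - rho / (1 + c) * n.+1%:R.
have c1 : 0 < 1 + c by rewrite ltr_wpDr.
pose K := Num.max (y N) 0.
have bound j : y (N + j)%N <= K.
  elim: j => [|j IH]; first by rewrite addn0 le_max lexx.
  rewrite addnS; set n := (N + j)%N in IH *.
  have n1 : (N1 <= n)%N by rewrite (leq_trans (leq_maxl _ _) (leq_addr _ _)).
  have n2 : (N2 <= n)%N by rewrite (leq_trans (leq_maxr _ _) (leq_addr _ _)).
  have t0 : 0 < n.+1%:R :> R by rewrite ltr0n.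
  have cn : c <= n.+1%:R by apply: (HN2 n.+1) => /=; exact: leqW.
  have step : y n.+1 <= (1 - c / n.+1%:R) * y n.
    rewrite /y lerBlDr; apply: le_trans (rec n n1) _.
    rewrite -(natr1 n.+1) le_eqVlt; apply/orP; left; apply/eqP; field.
    by rewrite lt0r_neq0 //= natr1 ?lt0r_neq0.
  have K0 : 0 <= K by rewrite le_max lexx orbT.
  have a0 : 0 <= 1 - c / n.+1%:R by rewrite subr_ge0 ler_pdivrMr // mul1r.
  apply: (le_trans step); apply: (@le_trans _ _ ((1 - c / n.+1%:R) * K)).
    exact: ler_wpM2l.
  by rewrite ler_piMl // gerBl divr_ge0 // ltW.
near=> n.
have Nn : (N <= n)%N by near: n; exact: nbhs_infty_ge.
have := bound (n - N)%N; rewrite subnKC // /y lerBlDl mulrDl => /le_trans; apply.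
rewrite lerD2l mulrC -ler_pdivrMr //.
apply: (@le_trans _ _ n%:R); last by rewrite ler_nat.
by near: n; exact: nbhs_infty_ger.
Unshelve. all: by end_near. Qed.

(** The two forms in which the recursion is solved: the forcing term is known
    up to an arbitrarily small error. *)
Lemma damped_recursion_limsup u c rho : 0 <= c ->
  (forall e, 0 < e ->
    \forall n \near \oo, u n.+1 <= (1 - c / n.+1%:R) * u n + (rho + e)) ->
  forall eps, 0 < eps ->
    \forall n \near \oo, u n <= (rho / (1 + c) + eps) * n.+1%:R.
Proof.
move=> c0 rec eps eps0; have e2 : 0 < eps / 2 by rewrite divr_gt0.
apply: filterS (damped_recursion_upper c0 (rec _ e2) e2) => n /le_trans; apply.
rewrite ler_pM2r ?ltr0n // mulrDl -addrA lerD2l [leRHS]splitr lerD2r.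
by rewrite ler_pdivrMr ?ltr_wpDr // ler_peMr ?lerDl // ltW.
Qed.

Lemma damped_recursion_liminf u c rho : 0 <= c ->
  (forall e, 0 < e ->
    \forall n \near \oo, (1 - c / n.+1%:R) * u n + (rho - e) <= u n.+1) ->
  forall eps, 0 < eps ->
    \forall n \near \oo, (rho / (1 + c) - eps) * n.+1%:R <= u n.
Proof.
move=> c0 rec eps eps0.
have recN e : 0 < e -> \forall n \near \oo,
    - u n.+1 <= (1 - c / n.+1%:R) * - u n + (- rho + e).
  move=> e0; apply: filterS (rec e e0) => n h.
  have -> : - rho + e = - (rho - e) by ring.
  by rewrite mulrN -opprD lerN2.
have := @damped_recursion_limsup (fun n => - u n) c (- rho) c0 recN eps eps0.
by apply: filterS => n h; rewrite -lerN2 -mulNr opprB addrC -mulNr.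
Qed.

End Recursion.

(** * Limiting degree frequencies *)

Section Stationary.
Local Open Scope classical_set_scope.
Local Open Scope ring_scope.
Context {R : realType}.
Variables alpha mu zeta : R.
Hypotheses (alpha01 : 0 < alpha < 1) (mu02 : 0 < mu <= 2) (zeta0 : 0 < zeta).

Notation rate := (gain_rate alpha mu zeta).

Let rate_ge0 k : 0 <= rate k. Proof. exact: gain_rate_ge0. Qed.

Let rate1_gt0 k : 0 < 1 + rate k.
Proof. by rewrite ltr_wpDr. Qed.

Let eventually_le_time (r : R) : \forall n \near \oo, r <= n.+2%:R.
Proof.
by apply: filterS (nbhs_infty_ger r) => n /le_trans; apply; rewrite ler_nat ltnW.
Qed.

Let damping_absorbs k (e : R) : 0 < e -> rate k * (e / 2 / (1 + rate k)) <= e / 2.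
Proof.
move=> e0; rewrite mulrA ler_pdivrMr // mulrC ler_wpM2l ?lerDr //.
by rewrite divr_ge0 // ltW.
Qed.

(** The frequencies at which the flow into each degree class, from the class
    below and from new vertices arriving at rate [f], balances its growth. *)
Fixpoint stationary (f : nat -> R) (k : nat) : R :=
  if k is k'.+1 then (rate k' * stationary f k' + f k) / (1 + rate k)
  else f 0%N / (1 + rate 0).

Lemma stationary_ge0 f k : (forall k, 0 <= f k) -> 0 <= stationary f k.
Proof.
move=> f0; elim: k => [|k IH] /=; apply: divr_ge0 => //; try exact: ltW.
by rewrite addr_ge0 // mulr_ge0.
Qed.

Lemma mean_degree_count_limsup k eps : 0 < eps ->
  \forall n \near \oo, mean_degree_count alpha mu zeta k n
    <= (stationary (newborn_bound mu zeta) k + eps) * n.+1%:R.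
Proof.
elim: k eps => [|k IH] eps eps0 /=; apply: damped_recursion_limsup => // e e0.
  near=> n; apply: le_trans (mean_degree_count0_le alpha01 mu02 zeta0 _) _.
    by near: n; exact: eventually_le_time.
  by rewrite -addrA !lerD2l; near: n; exact: gain_error_small.
have e2 : 0 < e / 2 / (1 + rate k) by rewrite !divr_gt0.
have e4 : 0 < e / 4 by rewrite divr_gt0.
near=> n; apply: le_trans (mean_degree_countS_le alpha01 mu02 zeta0 _ _) _.
  by near: n; exact: eventually_le_time.
rewrite -!addrA lerD2l.
have err : law_mean alpha mu zeta (@gain_error _ alpha mu zeta n) <= e / 4.
  by near: n; exact: gain_error_small.
have cnt : rate k / n.+1%:R * mean_degree_count alpha mu zeta k n
    <= rate k * stationary (newborn_bound mu zeta) k + e / 2.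
  apply: (@le_trans _ _ (rate k / n.+1%:R *
      ((stationary (newborn_bound mu zeta) k + e / 2 / (1 + rate k)) * n.+1%:R))).
    by rewrite ler_wpM2l ?divr_ge0 //; near: n; exact: IH.
  rewrite mulrACA mulVf ?pnatr_eq0 // mulr1 mulrDr lerD2l.
  exact: damping_absorbs.
move: err cnt; move: (rate k / _ * _) (rate k * stationary _ _) (law_mean _ _ _ _).
move: (newborn_bound _ _ _).
by move=> b x y z err cnt; lra.
Unshelve. all: by end_near. Qed.

(** For the lower bound, vertices born isolated under the classical rule are
    enough. *)
Definition isolated_newborns (k : nat) : R :=
  if k is 0%N then (1 - alpha) * expR (- (2 * zeta)) else 0.

Lemma mean_degree_count_liminf k eps : 0 < eps ->
  \forall n \near \oo, (stationary isolated_newborns k - eps) * n.+1%:R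
    <= mean_degree_count alpha mu zeta k n.
Proof.
elim: k eps => [|k IH] eps eps0 /=; apply: damped_recursion_liminf => // e e0.
  near=> n; apply: le_trans (mean_degree_count0_ge alpha01 mu02 zeta0 _).
    rewrite addrA lerD2l lerN2.
    by near: n; exact: gain_error_small.
  by near: n; exact: eventually_le_time.
have e2 : 0 < e / 2 / (1 + rate k) by rewrite !divr_gt0.
have e4 : 0 < e / 4 by rewrite divr_gt0.
near=> n; apply: le_trans (mean_degree_countS_ge alpha01 mu02 zeta0 _ _).
  rewrite -!addrA lerD2l.
  have err : law_mean alpha mu zeta (@gain_error _ alpha mu zeta n) <= e / 4.
    by near: n; exact: gain_error_small.
  have cnt : rate k * stationary isolated_newborns k - e / 2
      <= rate k / n.+1%:R * mean_degree_count alpha mu zeta k n.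
    apply: (@le_trans _ _ (rate k / n.+1%:R *
        ((stationary isolated_newborns k - e / 2 / (1 + rate k)) * n.+1%:R))); last first.
      by rewrite ler_wpM2l ?divr_ge0 //; near: n; exact: IH.
    rewrite mulrACA mulVf ?pnatr_eq0 // mulr1 mulrBr lerD2l lerN2.
    exact: damping_absorbs.
  move: err cnt; move: (rate k / _ * _) (rate k * stationary _ _) (law_mean _ _ _ _).
  by move=> x y z err cnt; lra.
by near: n; exact: eventually_le_time.
Unshelve. all: by end_near. Qed.

End Stationary.

(** * Power-law bounds *)

Section PowerLaw.
Context {R : realType}.

Lemma bernoulli_powR (a p : R) : 0 <= a -> 1 < p -> 1 + p * (a - 1) <= a `^ p.
Proof.
move=> a0 p1; have p0 : 0 < p by lra.
have q0 : 0 < 1 - p^-1 by rewrite subr_gt0 invf_lt1.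
have := @conjugate_powR R a 1 p (1 - p^-1)^-1 a0 ler01 p0.
rewrite invr_gt0 q0 invrK subrKC => /(_ isT erefl).
rewrite powR1 mulr1 mul1r -(ler_pM2l p0) mulrDr mulrBr [p * (_ / p)]mulrC divfK ?lt0r_neq0 //.
by rewrite mulfV ?lt0r_neq0 //; lra.
Qed.

(** Both comparisons are Bernoulli's inequality, since
    x / (x + p) = 1 - p / (x + p) = 1 / (1 + p / x). *)
Lemma ratio_le_powR (x p : R) : 0 < x -> 1 < p ->
  x / (x + p) <= ((x + p - 1) / (x + p)) `^ p.
Proof.
move=> x0 p1; have xp : 0 < x + p by lra.
apply: le_trans (bernoulli_powR _ p1); last by rewrite divr_ge0 //; lra.
rewrite le_eqVlt; apply/orP; left; apply/eqP; field.
exact: lt0r_neq0.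
Qed.

Lemma powR_le_ratio (x p : R) : 0 < x -> 1 < p ->
  (x / (x + 1)) `^ p <= x / (x + p).
Proof.
move=> x0 p1; have xp : 0 < x + p by lra.
have x1 : 0 < x + 1 by lra.
rewrite -(invf_div (x + 1) x) -(invf_div (x + p) x).
have a0 : 0 < (x + 1) / x by exact: divr_gt0.
rewrite -(powR_inv1 (ltW a0)) powRAC powR_inv1 ?powR_ge0 //.
rewrite lef_pV2 ?posrE ?powR_gt0 ?divr_gt0 //.
apply: le_trans (bernoulli_powR (ltW a0) p1).
rewrite le_eqVlt; apply/orP; left; apply/eqP; field.
exact: lt0r_neq0.
Qed.

Lemma powR_le_expR (y p : R) : 0 <= y -> 0 < p -> y `^ p <= p `^ p * expR y.
Proof.
move=> y0 p0; have -> : y = p * (y / p) by field; exact: lt0r_neq0.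
have yp : 0 <= y / p by rewrite divr_ge0 // ltW.
rewrite powRM ?(ltW p0) // ler_wpM2l ?powR_ge0 //.
rewrite [p * _]mulrC expRM; apply: ge0_ler_powR; rewrite ?nnegrE ?expR_ge0 ?(ltW p0) //.
by apply: le_trans (expR_ge1Dx _); lra.
Qed.

Variables alpha mu zeta : R.
Hypotheses (alpha01 : 0 < alpha < 1) (mu02 : 0 < mu <= 2) (zeta0 : 0 < zeta).

Notation rate := (gain_rate alpha mu zeta).
Notation beta := (degree_exponent alpha mu zeta).

Let alpha_gt0 : 0 < alpha. Proof. by case/andP: alpha01. Qed.
Let calpha_gt0 : 0 < 1 - alpha.
Proof. by rewrite subr_gt0; case/andP: alpha01. Qed.
Let mu_gt0 : 0 < mu. Proof. by case/andP: mu02. Qed.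
Let m := mean_new_edges alpha mu zeta.
Let m_gt0 : 0 < m.
Proof. by rewrite /m /mean_new_edges addr_gt0 // mulr_gt0. Qed.

(** [gain_rate k] is proportional to k + [shift]. *)
Definition shift : R := (1 - alpha) * zeta / (alpha * mu / (2 * m)).

Let slope := alpha * mu / (2 * m).
Let slope_gt0 : 0 < slope. Proof. by rewrite divr_gt0 ?mulr_gt0. Qed.

Lemma shift_gt0 : 0 < shift.
Proof. by apply: divr_gt0 => //; exact: mulr_gt0. Qed.

Lemma gain_rateE k : rate k = slope * (k%:R + shift).
Proof.
by rewrite /gain_rate /shift -/m -/slope mulrDr [X in _ = _ + X]mulrC divfK ?lt0r_neq0.
Qed.

Lemma degree_exponentE : beta = 1 + slope^-1.
Proof.
rewrite /degree_exponent /slope /m /mean_new_edges; field.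
by move: m_gt0; rewrite /m /mean_new_edges => h; rewrite !lt0r_neq0 //.
Qed.

Lemma degree_exponent_gt1 : 1 < beta.
Proof. by rewrite degree_exponentE ltrDl invr_gt0. Qed.

Lemma gain_rate_ratio k :
  rate k / (1 + rate k.+1) = (k%:R + shift) / (k%:R + shift + beta).
Proof.
have := shift_gt0; rewrite !gain_rateE degree_exponentE -natr1.
have : 0 <= k%:R :> R by [].
move: (k%:R) slope slope_gt0 (shift) => x s s0 c x0 c0.
have h1 : 0 < 1 + s * (x + 1 + c) by rewrite addr_gt0 // mulr_gt0 //; lra.
have h2 : 0 < x + c + (1 + s^-1) 
  by apply: addr_gt0; [rewrite ltr_wpDl|rewrite addr_gt0 ?invr_gt0].
apply/eqP; rewrite eqr_div ?lt0r_neq0 //; apply/eqP; field.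
exact: lt0r_neq0.
Qed.

Lemma stationary_isolated_ge k :
  stationary alpha mu zeta (isolated_newborns alpha zeta) 0
    * (shift / (k%:R + shift)) `^ beta
  <= stationary alpha mu zeta (isolated_newborns alpha zeta) k.
Proof.
have c0 := shift_gt0; have b1 := degree_exponent_gt1.
set b := stationary _ _ _ _; have b0 j : 0 <= b j.
  apply: stationary_ge0 => // -[|i] //=.
  by rewrite mulr_ge0 ?expR_ge0 // ltW.
elim: k => [|k IH]; first by rewrite add0r divff ?lt0r_neq0 // powR1 mulr1.
have x0 : 0 < k%:R + shift by rewrite ltr_wpDl.
have x10 : 0 < k%:R + shift + 1 by rewrite addr_gt0.
have -> : b k.+1 = (k%:R + shift) / (k%:R + shift + beta) * b k.
  by rewrite -gain_rate_ratio /b /= addr0 mulrAC.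
have := powR_le_ratio x0 b1 => /(ler_wpM2r (b0 k)); apply: le_trans.
have -> : shift / (k.+1%:R + shift)
    = (k%:R + shift) / (k%:R + shift + 1) * (shift / (k%:R + shift)).
  by rewrite -natr1; field; rewrite !lt0r_neq0 //= addrAC.
rewrite powRM; first by rewrite mulrCA ler_wpM2l ?powR_ge0.
  by apply: divr_ge0; exact: ltW.
by apply: divr_ge0; exact: ltW.
Qed.

Lemma stationary_lower : exists2 C : R, 0 < C & forall k, (1 <= k)%N ->
  C * k%:R `^ (- beta) <= stationary alpha mu zeta (isolated_newborns alpha zeta) k.
Proof.
have c0 := shift_gt0; have b1 := degree_exponent_gt1.
set b := stationary _ _ _ _.
have b0 : 0 < b 0%N.
  apply: divr_gt0; first by rewrite mulr_gt0 // expR_gt0.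
  by rewrite ltr_wpDr // gain_rate_ge0.
exists (b 0%N * (shift / (1 + shift)) `^ beta).
  by rewrite mulr_gt0 // powR_gt0 // divr_gt0 // addr_gt0.
move=> k k1; apply: le_trans (stationary_isolated_ge k).
rewrite -/b -mulrA ler_wpM2l ?(ltW b0) //.
have k0 : 1 <= k%:R :> R by rewrite ler1n.
have s10 : 0 < 1 + shift by rewrite addr_gt0.
have cs : 0 <= shift / (1 + shift) by apply: divr_ge0; exact: ltW.
have -> : k%:R `^ (- beta) = k%:R^-1 `^ beta :> R.
  by rewrite -(powR_inv1 (ler0n _ k)) -powRrM mulN1r.
rewrite -powRM ?invr_ge0 //; apply: ge0_ler_powR; rewrite ?nnegrE.
- by lra.
- by rewrite mulr_ge0 ?invr_ge0.
- by rewrite divr_ge0 ?addr_ge0 // ltW.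
rewrite -mulrA ler_wpM2l ?(ltW c0) // -invfM lef_pV2 ?posrE.
- by nra.
- by rewrite mulr_gt0 //; lra.
- by lra.
Qed.

(** In the scale (k + shift + beta - 1) ^ (- beta) the homogeneous part of the
    recursion is a contraction, and the arrivals are summable because
    [newborn_bound] decays like exp (- 2 k). The bound carries the tail
    D exp (- k) of the sum to make the induction go through. *)
Lemma stationary_upper : exists2 C : R, 0 < C & forall k, (1 <= k)%N ->
  stationary alpha mu zeta (newborn_bound mu zeta) k <= C * k%:R `^ (- beta).
Proof.
have c0 := shift_gt0; have b1 := degree_exponent_gt1.
set f := newborn_bound mu zeta; set b := stationary _ _ _ _.
pose s := shift + beta - 1; have s0 : 0 < s by rewrite /s; lra.
have bt0 : 0 < beta by lra.
have f0 k : 0 <= f k by rewrite mulr_ge0 ?exprn_ge0 ?expR_ge0.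
have b0 k : 0 <= b k by exact: stationary_ge0.
pose w k := b k * (k%:R + s) `^ beta.
pose D := expR ((expR 2 - 1) * (mu + zeta)) * (beta `^ beta * expR s).
have D0 : 0 < D by rewrite !mulr_gt0 ?expR_gt0 ?powR_gt0.
have fD k : f k * (k%:R + s) `^ beta <= D * expR (- 1) ^+ k.
  rewrite /f /newborn_bound /D -!mulrA ler_wpM2l ?expR_ge0 //.
  apply: (@le_trans _ _ (expR (- 2) ^+ k * (beta `^ beta * expR (k%:R + s)))).
    by rewrite ler_wpM2l ?exprn_ge0 ?expR_ge0 // powR_le_expR // addr_ge0 // ltW.
  rewrite mulrCA ler_wpM2l ?powR_ge0 // -!expRM_natl -!expRD ler_expR; lra.
have wS k : w k.+1 <= w k + D * expR (- 1) ^+ k.+1.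
  have x0 : 0 < k%:R + shift by rewrite ltr_wpDl.
  have ks : k.+1%:R + s = k%:R + shift + beta by rewrite -natr1 /s; ring.
  have ks1 : k%:R + s = k%:R + shift + beta - 1 by rewrite /s; ring.
  have ks0 : 0 < k.+1%:R + s by rewrite addr_gt0.
  have k1s0 : 0 < k%:R + s by rewrite ltr_wpDl.
  have -> : w k.+1 = (rate k / (1 + rate k.+1)) * b k * (k.+1%:R + s) `^ beta
      + f k.+1 / (1 + rate k.+1) * (k.+1%:R + s) `^ beta.
    by rewrite /w /b /= -mulrDl; congr (_ * _); rewrite mulrDl mulrAC.
  apply: lerD.
    rewrite gain_rate_ratio mulrAC [leRHS]mulrC ler_wpM2r //.
    apply: le_trans (ler_wpM2r (powR_ge0 _ _) (ratio_le_powR x0 b1)) _.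
    rewrite -ks1 -ks -powRM ?divr_ge0 ?(ltW ks0) ?(ltW k1s0) //.
    by rewrite divfK ?lt0r_neq0.
  apply: le_trans (fD _); rewrite ler_wpM2r ?powR_ge0 //.
  rewrite ler_pdivrMr ?ler_peMr ?lerDl ?gain_rate_ge0 //.
  by rewrite ltr_wpDr ?gain_rate_ge0.
(* So D exp (- k) exceeds D exp (- k - 1) by at least the latter. *)
have e2 : 2 * expR (- 1) <= 1 :> R.
  rewrite expRN ler_pdivrMr ?expR_gt0 // mul1r.
  by have := expR_ge1Dx (1 : R); lra.
have wD k : w k <= w 0%N + D - D * expR (- 1) ^+ k.
  elim: k => [|k IH]; first by rewrite expr0 mulr1 addrK.
  apply: (le_trans (wS k)); move: IH.
  rewrite exprS; have : 0 <= D * expR (- 1) ^+ k.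
    by rewrite mulr_ge0 ?exprn_ge0 ?expR_ge0 // ltW.
  move: (w k) (w 0%N) (expR (- 1)) e2 => x y q q2.
  rewrite mulrCA; move: (D * q ^+ k) => z z0 xz; nra.
exists (w 0%N + D); first by rewrite ltr_wpDl // mulr_ge0 ?powR_ge0.
move=> k k1; have k0 : 0 < k%:R :> R by rewrite ltr0n.
rewrite powRN ler_pdivlMr ?powR_gt0 //.
apply: (@le_trans _ _ (w k)); last first.
  apply: le_trans (wD k) _; rewrite gerBl mulr_ge0 ?exprn_ge0 ?expR_ge0 //.
  exact: ltW.
apply: ler_wpM2l => //; apply: ge0_ler_powR; rewrite ?nnegrE //.
- exact: ltW.
- by rewrite addr_ge0 // ltW.
- by rewrite lerDl ltW.
Qed.

End PowerLaw.

(** * Identifying the law *)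

Section FiniteValued.
Local Open Scope classical_set_scope.
Local Open Scope ring_scope.
Context {R : realType} {d : measure_display} {T : measurableType d}.
Variable P : probability T R.

Lemma probability_fin_num (A : set T) : measurable A -> P A \is a fin_num.
Proof. by move=> mA; exact: fin_num_measure. Qed.

Lemma integral_sum_indic (F : finType) (A : F -> set T) (c : F -> R) :
  (forall x, measurable (A x)) -> (forall x, 0 <= c x) ->
  (\int[P]_w (\sum_x c x * \1_(A x) w)%:E = (\sum_x fine (P (A x)) * c x)%:E)%E.
Proof.
move=> mA c0; under eq_integral => w _ do rewrite -sumEFin.
rewrite ge0_integral_sum //; last 2 first.
- by move=> x; apply/measurable_EFinP; exact: measurable_funM.
- by move=> x w _; rewrite lee_fin mulr_ge0.
rewrite -sumEFin; apply: eq_bigr => x _.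
under eq_integral => w _ do rewrite EFinM.
rewrite ge0_integralZl_EFin //; last first.
  by apply/measurable_EFinP; exact: measurable_indic.
rewrite integral_indic // setIT EFinM muleC fineK //.
exact: probability_fin_num.
Qed.

Variables (F : finType) (X : T -> F).
Hypothesis mX : forall x, measurable [set w | X w = x].

Let value_indic (f : F -> R) w : f (X w) = \sum_x f x * \1_[set w | X w = x] w.
Proof.
rewrite (bigD1 (X w)) //= big1 => [|x /eqP xX]; rewrite indicE.
  by rewrite mem_set // mulr1 addr0.
by rewrite memNset ?mulr0 // => /esym.
Qed.

Lemma expectation_finite_valued (f : F -> R) : (forall x, 0 <= f x) ->
  ('E_P[fun w => f (X w)] = (\sum_x fine (P [set w | X w = x]) * f x)%:E)%E.
Proof.
move=> f0; rewrite unlock -integral_sum_indic //.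
by apply: eq_integral => w _; rewrite value_indic.
Qed.

Lemma probability_partition (A : set T) : measurable A ->
  fine (P A) = \sum_x fine (P (A `&` [set w | X w = x])).
Proof.
move=> mA; apply: EFin_inj; rewrite fineK ?probability_fin_num //.
have := @integral_sum_indic F (fun x => A `&` [set w | X w = x]) (fun=> 1).
move=> /(_ (fun x => measurableI _ _ mA (mX x)) (fun=> ler01)).
under [in RHS]eq_bigr => x _ do rewrite mulr1.
move=> <-; have := integral_indic P measurableT mA; rewrite setIT => <-.
apply: eq_integral => w _; congr (_%:E).
transitivity (\1_A w * \sum_x 1 * \1_[set w | X w = x] w : R).
  by rewrite -(value_indic (fun=> 1) w) mulr1.
rewrite mulr_sumr.
by apply: eq_bigr => x _; rewrite !mul1r indicI.
Qed.

End FiniteValued.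

(** A nonnegative mass on a finite type that is entirely carried by the image
    of an injection may be summed along it. *)
Lemma sum_along_injection (R : realType) (X Y : finType) (p f : X -> R) (e : Y -> X) :
  injective e -> (forall x, 0 <= p x) -> \sum_x p x = \sum_y p (e y) ->
  \sum_x p x * f x = \sum_y p (e y) * f (e y).
Proof.
move=> e_inj p0 tot.
pose im := [set e y | y in Y]%SET.
have split (g : X -> R) :
    \sum_x g x = \sum_y g (e y) + \sum_(x | x \notin im) g x.
  rewrite (bigID (mem im)) /=; congr (_ + _).
  by rewrite big_imset //= => y y' _ _; exact: e_inj.
rewrite split [X in _ + X]big1 ?addr0 // => x xe.
have z : \sum_(x | x \notin im) p x = 0.
  by apply: (addrI (\sum_y p (e y))); rewrite -split addr0.
by rewrite (psumr_eq0P (fun x _ => p0 x) z) // mul0r.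
Qed.

Section ProcessLaw.
Local Open Scope classical_set_scope.
Local Open Scope ring_scope.
Context {R : realType} {d : measure_display} {T : measurableType d}.
Variables (alpha mu zeta : R) (P : probability T R) (G : forall t, T -> graph t).
Hypothesis process : is_graph_process alpha mu zeta P G.

Let measurable_state t (g : graph t) : (0 < t)%N -> measurable [set w | G t w = g].
Proof. by case: process => H _ _; exact: H. Qed.

Definition follows_after (j : nat) (h : forall t, graph t) (t : nat) : set T :=
  [set w | forall s, (j < s <= t)%N -> G s w = h s].

Lemma measurable_follows_after j h t : measurable (follows_after j h t).
Proof.
elim: t => [|t IH].
  rewrite (_ : follows_after _ _ _ = setT); first exact: measurableT.
  by apply/seteqP; split=> // w _ s; lia.
have [jt|tj] := ltnP j t.+1; last first.
  rewrite (_ : follows_after _ _ _ = setT); first exact: measurableT.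
  by apply/seteqP; split=> // w _ s; lia.
rewrite (_ : follows_after _ _ _
    = follows_after j h t `&` [set w | G t.+1 w = h t.+1]).
  by apply: measurableI => //; exact: measurable_state.
apply/seteqP; split=> w /=.
  by move=> H; split=> [s js|]; apply: H; lia.
case=> H1 H2 s /andP[js]; rewrite leq_eqVlt => /predU1P[->//|st].
by apply: H1; lia.
Qed.

(** Fixing the state at one more time splits the event according to the value
    of the state there. *)
Lemma follows_after_split j h t (g : graph j.+1) : (j < t)%N ->
  follows_after j.+1 h t `&` [set w | G j.+1 w = g]
  = follows_after j (eqtype.dfwith h g) t.
Proof.
move=> jt; apply/seteqP; split=> w /=.
  case=> H1 H2 s /andP[js st]; have [->|sj] := eqVneq s j.+1.
    by rewrite dfwith_in.
  by rewrite dfwith_out 1?eq_sym //; apply: H1; lia.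
move=> H; split=> [s /andP[js st]|].
  by rewrite H ?dfwith_out //; lia.
by rewrite H ?dfwith_in //; lia.
Qed.

(** The step condition conditions on the whole past; summing over the states
    at times 1, ..., j forgets them one by one. *)
Lemma window_step j t h (S : {set 'I_t.+1}) : (j < t)%N ->
  fine (P (follows_after j h t `&` [set w | G t.+1 w = extend (h t) S]))
  = fine (P (follows_after j h t)) * attach_prob alpha mu zeta (h t) S.
Proof.
elim: j h => [|j IH] h jt.
  case: process => _ _ /(_ t h S jt) ->.
  by rewrite fineM // probability_fin_num //; exact: measurable_follows_after.
have mj := fun g => @measurable_state j.+1 g (ltn0Sn j).
have mf := @measurable_follows_after j.+1 h t.
rewrite (probability_partition P mj mf) (probability_partition P mj); last first.
  by apply: measurableI => //; exact: measurable_state.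
rewrite mulr_suml; apply: eq_bigr => g _.
have ht : eqtype.dfwith h g t = h t by rewrite dfwith_out //; lia.
rewrite setIAC follows_after_split ?(ltnW jt) // -ht.
exact: IH (ltnW jt).
Qed.

Lemma transition t (g : graph t) S : (0 < t)%N ->
  fine (P ([set w | G t w = g] `&` [set w | G t.+1 w = extend g S]))
  = fine (P [set w | G t w = g]) * attach_prob alpha mu zeta g S.
Proof.
move=> t0; pose h := @eqtype.dfwith nat graph (fun s => finset.set0) t g.
have ht : h t = g by exact: dfwith_in.
have := @window_step t.-1 t h S; rewrite ht.
(* Only time t is left of the past, and h t = g. *)
suff -> : follows_after t.-1 h t = [set w | G t w = g] by apply; rewrite prednK.
apply/seteqP; split=> w /=.
  by move=> /(_ t); rewrite ht; apply; lia.
by move=> Gt s st; rewrite (_ : s = t) ?ht //; lia.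
Qed.

(** The step condition gives the joint probability of a graph and each of its
    extensions.  These already add up to the probability of the graph, so that
    the next state is almost surely an extension of the current one. *)
Lemma law_of_process n (f : graph n.+1 -> R) :
  \sum_g fine (P [set w | G n.+1 w = g]) * f g = law_mean alpha mu zeta f.
Proof.
have tot t : (0 < t)%N -> \sum_(g : graph t) fine (P [set w | G t w = g]) = 1.
  move=> t0; have := probability_partition P (fun g => measurable_state g t0) measurableT.
  rewrite probability_setT /= => ->.
  by apply: eq_bigr => g _; rewrite setTI.
elim: n f => [|n IH] f.
  have init : fine (P [set w | G 1%N w = initial_graph]) = 1.
    by case: process => _ -> _.
  rewrite (@sum_along_injection _ _ unit _ _ (fun=> initial_graph)).
  - by rewrite (big_pred1 tt) /= ?init ?mul1r // => -[].
  - by case=> [] [].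
  - by move=> g; exact: fine_ge0.
  - by rewrite tot // (big_pred1 tt) /= ?init // => -[].
rewrite law_meanS -IH.
pose J (g : graph n.+1) (g' : graph n.+2) : R :=
  fine (P ([set w | G n.+1 w = g] `&` [set w | G n.+2 w = g'])).
transitivity (\sum_g' \sum_g J g g' * f g').
  apply: eq_bigr => g' _; rewrite -mulr_suml; congr (_ * _).
  rewrite (probability_partition P (fun g => @measurable_state n.+1 g isT)).
    by apply: eq_bigr => g _; rewrite setIC.
  exact: measurable_state.
rewrite exchange_big; apply: eq_bigr => g _.
have JE S : J g (extend g S)
    = fine (P [set w | G n.+1 w = g]) * attach_prob alpha mu zeta g S.
  exact: transition.
rewrite (@sum_along_injection _ _ _ _ _ (@extend n.+1 g)).
- by rewrite mulr_sumr; apply: eq_bigr => S _; rewrite JE mulrA.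
- exact: extend_inj.
- by move=> g'; exact: fine_ge0.
under [RHS]eq_bigr => S _ do rewrite JE -[attach_prob _ _ _ _ _]mulr1.
rewrite -mulr_sumr -/(attach_mean alpha mu zeta g (fun=> 1)) attach_mean1 mulr1.
rewrite (probability_partition P (fun g => @measurable_state n.+2 g isT)) //.
exact: measurable_state.
Qed.

Lemma mean_proportionE k n :
  mean_proportion P G k n.+1
  = (mean_degree_count alpha mu zeta k n / n.+1%:R)%:E.
Proof.
rewrite /mean_proportion /mean_num_degree EFinM; congr (_ * _)%E.
rewrite (expectation_finite_valued (F := graph n.+1) (X := G n.+1) P _
  (f := fun g => (num_degree k g)%:R)) //.
  by rewrite law_of_process.
by move=> g; exact: measurable_state.
Qed.

End ProcessLaw.

(** * Degree frequencies of the process *)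

Section LimitBounds.
Local Open Scope classical_set_scope.
Local Open Scope ring_scope.
Context {R : realType}.

Lemma limn_esup_le (u : nat -> \bar R) (l : R) :
  (forall eps, 0 < eps -> \forall n \near \oo, (u n <= (l + eps)%:E)%E) ->
  (limn_esup u <= l%:E)%E.
Proof.
move=> ul; apply/lee_addgt0Pr => eps eps0.
apply: (@le_trans _ _ (ereal_sup (u @` [set n | (u n <= (l + eps)%:E)%E]))).
  by apply: ereal_inf_lbound => /=; exists [set n | (u n <= (l + eps)%:E)%E] => //; exact: ul.
by apply: ge_ereal_sup => _ [n /= h <-].
Qed.

Lemma limn_einf_ge (u : nat -> \bar R) (l : R) :
  (forall eps, 0 < eps -> \forall n \near \oo, ((l - eps)%:E <= u n)%E) ->
  (l%:E <= limn_einf u)%E.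
Proof.
move=> ul; rewrite /limn_einf leeNr -EFinN; apply: limn_esup_le => eps eps0.
apply: filterS (ul eps eps0) => n; rewrite -leeN2 -EFinN.
by rewrite opprB addrC.
Qed.

Lemma near_succ (Q : nat -> Prop) :
  (\forall n \near \oo, Q n.+1) -> \forall n \near \oo, Q n.
Proof. by case=> N _ HN; exists N.+1 => // -[//|n] /= Nn; exact: HN. Qed.

Variables (d : measure_display) (T : measurableType d).
Variables (alpha mu zeta : R) (P : probability T R) (G : forall t, T -> graph t).
Hypotheses (alpha01 : 0 < alpha < 1) (mu02 : 0 < mu <= 2) (zeta0 : 0 < zeta).
Hypothesis process : is_graph_process alpha mu zeta P G.

Lemma mean_proportion_limsup k :
  (limn_esup (mean_proportion P G k)
    <= (stationary alpha mu zeta (newborn_bound mu zeta) k)%:E)%E.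
Proof.
apply: limn_esup_le => eps eps0; apply: near_succ.
apply: filterS (mean_degree_count_limsup alpha01 mu02 zeta0 k eps0) => n h.
by rewrite (mean_proportionE process) lee_fin ler_pdivrMr.
Qed.

Lemma mean_proportion_liminf k :
  ((stationary alpha mu zeta (isolated_newborns alpha zeta) k)%:E
    <= limn_einf (mean_proportion P G k))%E.
Proof.
apply: limn_einf_ge => eps eps0; apply: near_succ.
apply: filterS (mean_degree_count_liminf alpha01 mu02 zeta0 k eps0) => n h.
by rewrite (mean_proportionE process) lee_fin ler_pdivlMr.
Qed.

End LimitBounds.

Theorem corollary1p3 (R : realType) (alpha mu zeta : R)
    (halpha : 0 < alpha < 1) (hmu : 0 < mu <= 2) (hzeta : 0 < zeta) :
  exists C1 C2 : R, 0 < C1 /\ 0 < C2 /\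
    forall (d : measure_display) (T : measurableType d) (P : probability T R)
      (G : forall t : nat, T -> graph t),
      is_graph_process alpha mu zeta P G ->
      forall k : nat, (1 <= k)%N ->
        [/\ ((C1 * k%:R `^ (- degree_exponent alpha mu zeta))%:E
               <= limn_einf (mean_proportion P G k))%E,
            (limn_einf (mean_proportion P G k)
               <= limn_esup (mean_proportion P G k))%E
          & (limn_esup (mean_proportion P G k)
               <= (C2 * k%:R `^ (- degree_exponent alpha mu zeta))%:E)%E].
Proof.
have [C1 C1_gt0 lower] := stationary_lower halpha hmu hzeta.
have [C2 C2_gt0 upper] := stationary_upper halpha hmu hzeta.
exists C1, C2; split=> //; split=> // d T P G process k k1; split.
- apply: le_trans (mean_proportion_liminf halpha hmu hzeta process k).
  by rewrite lee_fin lower.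
- exact: limn_einf_sup.
- apply: le_trans (mean_proportion_limsup halpha hmu hzeta process k) _.
  by rewrite lee_fin upper.
Qed.
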